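(* Let $M\in\mathbb{R}^{n\times n}$ be symmetric positive definite and tridiagonal, with smallest and largest eigenvalues $\lambda_{\min}$ and $\lambda_{\max}$, and let $S=M\otimes I_n+I_n\otimes M$. For $k,t\in\{1,\ldots,n^2\}$ let $$j=\lfloor (t-1)/n\rfloor+1,\quad i=t-n\lfloor (t-1)/n\rfloor,\quad m=\lfloor (k-1)/n\rfloor+1,\quad \ell=k-n\lfloor (k-1)/n\rfloor .$$ (i) Let $\mathfrak{n}_2:=|\ell-i|+|m-j|-2>0$. If $\ell\ne i$ and $m\ne j$, then $$|(S^{-1})_{k,t}|\le\frac{1}{2\sqrt2}\,\frac{(\lambda_{\max}-\lambda_{\min})^{\mathfrak{n}_2+2}}{(\lambda_{\max}^2+\lambda_{\min}^2)^{\mathfrak{n}_2/2}}\,\frac{\sqrt{\lambda_{\max}^2+\lambda_{\min}^2}}{(\lambda_{\max}\lambda_{\min})^2}\,\frac{1}{\sqrt{\mathfrak{n}_2}}\sqrt{\frac{2\mathfrak{n}_2}{\mathfrak{n}_2+4}} .$$ (ii) Let $\mathfrak{n}_1:=|\ell-i|+|m-j|-1>0$. If either $\ell=i$ or $m=j$, then $$|(S^{-1})_{k,t}|\le\frac{1}{2\sqrt2}\,\frac{(\lambda_{\max}-\lambda_{\min})^{\mathfrak{n}_1+1}}{(\lambda_{\max}^2+\lambda_{\min}^2)^{\mathfrak{n}_1/2}}\,\frac{\sqrt{\lambda_{\max}^2+\lambda_{\min}^2}}{\lambda_{\max}\lambda_{\min}^2}\,\frac{1}{\sqrt{\mathfrak{n}_1}}\sqrt{\frac{2\mathfrak{n}_1}{\mathfrak{n}_1+2}}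 .$$
   Context: $I_n$ is the $n\times n$ identity matrix and $\otimes$ is the Kronecker product. *)

(* Defs.v *)
From mathcomp Require Import all_boot all_order all_algebra.
From mathcomp Require Export mxtens.

Set Implicit Arguments.
Unset Strict Implicit.
Unset Printing Implicit Defensive.

Import Order.TTheory GRing.Theory Num.Theory IntDist.
Local Open Scope ring_scope.

Definition tridiagonal (R : pzRingType) (n : nat) (M : 'M[R]_n) : Prop :=
  forall p q : 'I_n, (1 < `|p - q|)%N -> M p q = 0.

Definition posdefmx (R : numDomainType) (n : nat) (M : 'M[R]_n) : Prop :=
  forall x : 'cV[R]_n, x != 0 -> 0 < (x^T *m M *m x) 0 0.

Definition smallest_eigenvalue (R : realFieldType) (n : nat)
    (M : 'M[R]_n) (a : R) : Prop :=
  eigenvalue M a /\ forall b : R, eigenvalue M b -> a <= b.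

Definition largest_eigenvalue (R : realFieldType) (n : nat)
    (M : 'M[R]_n) (a : R) : Prop :=
  eigenvalue M a /\ forall b : R, eigenvalue M b -> b <= a.

(* A 1-based index t in {1, ..., n^2} designates position [row_of n t] inside
   the block [block_of n t], both again 1-based. *)
Definition block_of (n t : nat) : nat := ((t - 1) %/ n + 1)%N.
Definition row_of (n t : nat) : nat := (t - n * ((t - 1) %/ n))%N.

Definition kron_sum (R : pzRingType) (n : nat) (M : 'M[R]_n) :
    'M[R]_(n * n) :=
  M *t 1%:M + 1%:M *t M.

(* Main.v *)
Require Import Defs.
From mathcomp Require Import all_boot all_order all_algebra.
From mathcomp Require Import reals exp.
From mathcomp Require Import spectral sesquilinear complex ring lra zify.

Set Implicit Arguments.
Unset Strict Implicit.
Unset Printing Implicit Defensive.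

Import Order.TTheory GRing.Theory Num.Theory IntDist.
Local Open Scope ring_scope.

(** Write [a] and [b] for the extreme eigenvalues of [M].  The eigenvalues of
    [S] are the sums of two eigenvalues of [M], so they lie in [[2a, 2b]], and
    [B = 1 - S / (a + b)] has spectral radius at most [(b - a) / (a + b)].
    Truncating the Neumann series of the inverse of [S] after [d] terms gives
      [S^-1 = (a + b)^-1 * (1 + B + ... + B^(d-1)) + S^-1 * B^d].
    On the [n] by [n] grid of positions (block, row), the matrix [S], hence
    also [B], couples only points at [l1] distance at most one, because [M] is
    tridiagonal.  So [B^p] vanishes between points at distance more than [p],
    and when [d] is the distance between [k] and [t] the whole truncated series
    vanishes at [(k, t)].  What remains is an entry of [S^-1 * B^d], at most
    the spectral norm of that matrix:
      [|(S^-1)_(k,t)| <= (2a)^-1 * ((b - a) / (a + b))^d]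
    (lemma [kron_sum_inverse_decay]).

    Both bounds of the theorem follow.  They have [sqrt (a^2 + b^2)] where the
    estimate above has the larger [a + b], so they decay more slowly with [d];
    this pays for their extra factor [1 / sqrt d], by a Bernoulli inequality
    for the ratio of [(a + b)^2] to [a^2 + b^2] (lemma [bernoulli_ratio]).

    The spectral facts go through the unitary diagonalisation of a hermitian
    matrix over a closed field containing the given real one. *)

(** * Unitarily diagonalised matrices *)

Section UnitaryDiagonal.
Variables (C : numClosedFieldType) (n : nat) (W : 'M[C]_n).
Local Open Scope sesquilinear_scope.

Definition unitary_diag (f : 'I_n -> C) : 'M[C]_n :=
  W^t* *m diag_mx (\row_r f r) *m W.

Lemma eq_unitary_diag f g : f =1 g -> unitary_diag f = unitary_diag g.
Proof.
by move=> fg; congr (_ *m diag_mx _ *m _); apply/rowP => r; rewrite !mxE.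
Qed.

Hypothesis unitaryW : W \is unitarymx.

Lemma unitary_diagM f g :
  unitary_diag f *m unitary_diag g = unitary_diag (fun r => f r * g r).
Proof.
rewrite /unitary_diag !mulmxA mulmxtVK // -[_ *m diag_mx _ *m diag_mx _]mulmxA.
by rewrite mulmx_diag; congr (_ *m diag_mx _ *m _); apply/rowP => r; rewrite !mxE.
Qed.

Lemma unitary_diag1 : unitary_diag (fun=> 1) = 1%:M.
Proof.
rewrite /unitary_diag (_ : \row__ 1 = const_mx 1); last first.
  by apply/rowP=> r; rewrite !mxE.
rewrite diag_const_mx mulmx1; move: (unitaryW).
by rewrite -trmxC_unitary => /unitarymxP; rewrite trmxCK.
Qed.

Lemma unitary_diagD f g :
  unitary_diag f + unitary_diag g = unitary_diag (fun r => f r + g r).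
Proof.
rewrite /unitary_diag -mulmxDl -mulmxDr -raddfD; congr (_ *m diag_mx _ *m _).
by apply/rowP => r; rewrite !mxE.
Qed.

Lemma unitary_diagZ c f :
  c *: unitary_diag f = unitary_diag (fun r => c * f r).
Proof.
rewrite /unitary_diag scalemxAl scalemxAr -linearZ.
by congr (_ *m diag_mx _ *m _); apply/rowP => r; rewrite !mxE.
Qed.

Lemma unitary_diagX f d :
  unitary_diag f ^+ d = unitary_diag (fun r => f r ^+ d).
Proof.
elim: d => [|d IHd]; first by exact: esym unitary_diag1.
rewrite exprS IHd [_ * _]unitary_diagM.
by apply: eq_unitary_diag => r; rewrite exprS.
Qed.

(** The columns of [W] are unit vectors, so Cauchy-Schwarz bounds the entry.
    Averaging the squares of the two factors gives this form of
    Cauchy-Schwarz directly. *)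
Lemma unitary_diag_entry_le f B k t :
  (forall r, `|f r| <= B) -> `|unitary_diag f k t| <= B.
Proof.
move=> fB.
have colW s : \sum_r `|W r s| ^+ 2 = 1.
  have := congr1 (fun A : 'M_n => A s s) unitary_diag1.
  rewrite /unitary_diag mul_mx_diag !mxE eqxx => E; rewrite -[RHS]E.
  by apply: eq_bigr => r _; rewrite !mxE mulr1 normCKC.
have -> : unitary_diag f k t = \sum_r ((W r k)^* * f r * W r t).
  by rewrite /unitary_diag mul_mx_diag !mxE; apply: eq_bigr => r _; rewrite !mxE.
apply: le_trans (ler_norm_sum _ _ _) _.
have -> : B = \sum_r B * ((`|W r k| ^+ 2 + `|W r t| ^+ 2) / 2).
  by rewrite -mulr_sumr -mulr_suml big_split /= !colW; field.
apply: ler_sum => r _; rewrite !normrM norm_conjC mulrAC mulrC.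
apply: ler_pM => //; first by rewrite mulr_ge0.
rewrite ler_pdivlMr ?ltr0n // -subr_ge0.
rewrite (_ : _ - _ = (`|W r k| - `|W r t|) ^+ 2); last by ring.
by rewrite real_exprn_even_ge0 // realB ?normr_real.
Qed.

End UnitaryDiagonal.

Section UnitaryTensor.
Variables (C : numClosedFieldType) (m n : nat).
Variables (V : 'M[C]_m) (W : 'M[C]_n).
Local Open Scope sesquilinear_scope.

Lemma tensmx_adjoint : (V *t W)^t* = V^t* *t W^t*.
Proof. by apply/matrixP => r s; rewrite !mxE rmorphM. Qed.

Lemma tensmx_unitary :
  V \is unitarymx -> W \is unitarymx -> V *t W \is unitarymx.
Proof.
move=> /unitarymxP VV /unitarymxP WW; apply/unitarymxP.
rewrite tensmx_adjoint tensmx_mul VV WW; apply/matrixP => r s.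
by case: r / (mxtens_indexP r) => i j; case: s / (mxtens_indexP s) => i' j';
  rewrite tensmxE !mxE (can_eq (@mxtens_indexK _ _)) xpair_eqE -natrM mulnb.
Qed.

Lemma unitary_diag_tens f g :
  unitary_diag V f *t unitary_diag W g =
  unitary_diag (V *t W)
    (fun r => f (mxtens_unindex r).1 * g (mxtens_unindex r).2).
Proof.
rewrite /unitary_diag tensmx_adjoint -!tensmx_mul.
congr (_ *m _ *m _); apply/matrixP => r s.
case: r / (mxtens_indexP r) => i j; case: s / (mxtens_indexP s) => i' j'.
rewrite tensmxE !mxE !mxtens_indexK (can_eq (@mxtens_indexK _ _)) xpair_eqE.
by case: eqP; case: eqP; rewrite /= ?mulr1n ?mulr0n ?mul0r ?mulr0.
Qed.

End UnitaryTensor.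

(** * Spectral intervals of real matrices *)

(** The properties of the inclusion of a real closed field [R] in [R[i]] on
    which the spectral arguments rest: estimates pass from the closed field to
    [R] by the first one, and the eigenvalues of a hermitian matrix come from
    [R] by the second one. *)
Definition real_embedding (R : realFieldType) (C : numClosedFieldType)
    (toC : {rmorphism R -> C}) : Prop :=
  {mono toC : x y / x <= y} /\
  forall z, z \is Num.real -> exists x, toC x = z.

Section Spectral.
Variables (R : realFieldType) (C : numClosedFieldType).
Variables (toC : {rmorphism R -> C}) (toC_embedding : real_embedding toC).
Local Notation cplx := (map_mx toC).

Let toC_le : {mono toC : x y / x <= y}. Proof. by case: toC_embedding. Qed.

Let toC_real x : toC x \is Num.real.
Proof.
by rewrite realE -(rmorph0 toC) !toC_le; apply: num_real.
Qed.

Let toC_norm x : `|toC x| = toC `|x|.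
Proof.
have [x0|x0] := leP 0 x; first by rewrite !ger0_norm // -(rmorph0 toC) toC_le.
by rewrite !ltr0_norm ?rmorphN // -(rmorph0 toC) (leW_mono toC_le).
Qed.

(** The diagonalisation is part of the definition, since both Kronecker sums
    and polynomials in [A] are computed from it. *)
Definition spectrum_in n (A : 'M[R]_n) (lo hi : R) : Prop :=
  exists W mu, [/\ W \is unitarymx, cplx A = unitary_diag W (toC \o mu) &
    forall r : 'I_n, lo <= mu r <= hi].

Local Open Scope sesquilinear_scope.

(** The row [r] of the diagonalising unitary matrix is an eigenvector, so every
    diagonal coefficient is an eigenvalue of [M] over the closed field; being
    real, it is an eigenvalue over [R] as well. *)
Lemma symmetric_spectrum_in n (M : 'M[R]_n) (lo hi : R) :
    M^T = M -> (forall a, eigenvalue M a -> lo <= a <= hi) ->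
  spectrum_in M lo hi.
Proof.
move=> symM eigM.
have realM : (cplx M) \is a realmx.
  by apply/mxOverP => i j; rewrite mxE.
have hermM : (cplx M) \is hermsymmx.
  apply: realsym_hermsym => //; apply/is_hermitianmxP.
  by rewrite expr0 scale1r map_mx_id // map_trmx symM.
have /orthomx_spectralP MC := hermitian_normalmx hermM.
have realD := hermitian_spectral_diag_real hermM.
set W := spectralmx (cplx M) in MC; set D := spectral_diag (cplx M) in MC realD.
have uW : W \is unitarymx by exact: spectral_unitarymx.
have [mu muD] : exists mu : 'I_n -> R, forall r, toC (mu r) = D 0 r.
  apply: (@fin_all_exists _ (fun=> R) (fun r x => toC x = D 0 r)) => r.
  by apply: (proj2 toC_embedding); exact: (mxOverP realD).
have MCE : cplx M = unitary_diag W (toC \o mu).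
  rewrite {1}MC (invmx_unitary uW) /unitary_diag; congr (_ *m diag_mx _ *m _).
  by apply/rowP => r; rewrite mxE /= muD.
exists W, mu; split => // r; apply: eigM.
rewrite -(eigenvalue_map toC) muD; apply/eigenvalueP; exists (row r W).
  rewrite MC (invmx_unitary uW) !mulmxA -!row_mul (unitarymxP uW) mul1mx row_mul.
  by rewrite row_diag_mx -scalemxAl -rowE.
apply/eqP => W0; have /matrixP/(_ r r) := unitarymxP uW.
rewrite !mxE eqxx big1 => [/esym/eqP|j _]; first by rewrite oner_eq0.
by move/rowP: W0 => /(_ j); rewrite !mxE => ->; rewrite mul0r.
Qed.

(** If [W] diagonalises [M] then [W *t W] diagonalises both [M *t 1] and
    [1 *t M], and the eigenvalues add up. *)
Lemma kron_sum_spectrum_in n (M : 'M[R]_n) (lo hi : R) :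
  spectrum_in M lo hi -> spectrum_in (kron_sum M) (2 * lo) (2 * hi).
Proof.
move=> [W [mu [uW MW muP]]].
exists (W *t W), (fun r => mu (mxtens_unindex r).1 + mu (mxtens_unindex r).2).
split; first exact: tensmx_unitary.
  rewrite /kron_sum map_mxD !map_mxT map_mx1 MW -(unitary_diag1 uW).
  rewrite !unitary_diag_tens unitary_diagD.
  by apply: eq_unitary_diag => r /=; rewrite mulr1 mul1r rmorphD.
move=> r; move: (muP (mxtens_unindex r).1) (muP (mxtens_unindex r).2); lra.
Qed.

(** * Decay of the inverse of a banded matrix *)

Section InverseDecay.
Variables (n : nat) (A : 'M[R]_n) (lo hi : R).
Hypotheses (lo_gt0 : 0 < lo) (specA : spectrum_in A lo hi).

(** The factor [2 / (lo + hi)] centres the spectrum of [B] at zero, which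
    minimises its radius. *)
Let B : 'M[R]_n := 1 - (2 / (lo + hi)) *: A.

Lemma spectrum_in_unitmx : A \in unitmx.
Proof.
have [W [mu [uW AW muP]]] := specA.
rewrite -(map_unitmx toC) AW.
have mu_neq0 r : toC (mu r) != 0.
  by rewrite fmorph_eq0 gt_eqF // (lt_le_trans lo_gt0) //; case/andP: (muP r).
have AV : unitary_diag W (toC \o mu) *m
    unitary_diag W (fun r => (toC (mu r))^-1) = 1%:M.
  rewrite (unitary_diagM uW).
  apply: etrans (unitary_diag1 uW).
  by apply: eq_unitary_diag => r /=; rewrite mulfV.
by have [] := mulmx1_unit AV.
Qed.

(** The remainder of the Neumann series is diagonalised together with [A], so
    it suffices to bound [mu^-1 * (1 - 2 mu / (lo + hi))^d] on [[lo, hi]]. *)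
Lemma inverse_remainder_entry_le d k t :
  `|(invmx A *m B ^+ d) k t| <= lo^-1 * ((hi - lo) / (lo + hi)) ^+ d.
Proof.
have [W [mu [uW AW muP]]] := specA.
have mu_gt0 r : 0 < mu r.
  by rewrite (lt_le_trans lo_gt0) //; case/andP: (muP r).
set f := fun r : 'I_n => (mu r)^-1 * (1 - 2 / (lo + hi) * mu r) ^+ d.
have invA : cplx (invmx A) = unitary_diag W (fun r => (toC (mu r))^-1).
  rewrite map_invmx; apply: (can_inj (mulKmx (_ : cplx A \in unitmx))).
    by rewrite map_unitmx spectrum_in_unitmx.
  rewrite mulmxV ?map_unitmx ?spectrum_in_unitmx // AW (unitary_diagM uW).
  rewrite -(unitary_diag1 uW); apply: eq_unitary_diag => r /=.
  by rewrite mulfV // fmorph_eq0 gt_eqF.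
have BW : cplx B = unitary_diag W (fun r => toC (1 - 2 / (lo + hi) * mu r)).
  rewrite /B -scaleNr map_mxD map_mx1 map_mxZ AW -(unitary_diag1 uW).
  rewrite unitary_diagZ unitary_diagD; apply: eq_unitary_diag => r /=.
  by rewrite -rmorphM -(rmorph1 toC) -rmorphD mulNr.
have E : cplx (invmx A *m B ^+ d) = unitary_diag W (toC \o f).
  rewrite map_mxM rmorphXn /= BW invA (unitary_diagX uW) (unitary_diagM uW).
  apply: eq_unitary_diag => r /=.
  by rewrite -rmorphXn -fmorphV -rmorphM.
have := @unitary_diag_entry_le _ _ W uW (toC \o f)
  (toC (lo^-1 * ((hi - lo) / (lo + hi)) ^+ d)) k t.
rewrite -E mxE toC_norm toC_le; apply=> r /=; rewrite toC_norm toC_le.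
have /andP[lo_mu mu_hi] := muP r.
have s_gt0 : 0 < lo + hi by move: lo_gt0; lra.
rewrite /f normrM (gtr0_norm (_ : 0 < (mu r)^-1)) ?invr_gt0 // normrX.
apply: ler_pM; rewrite ?exprn_ge0 ?invr_ge0 ?(ltW (mu_gt0 r)) //.
  by rewrite lef_pV2 ?posrE.
have rho_ge0 : 0 <= (hi - lo) / (lo + hi) by apply: divr_ge0; lra.
rewrite lerXn2r ?nnegrE //.
rewrite (_ : 1 - _ = (lo + hi - 2 * mu r) / (lo + hi)); last first.
  by field; rewrite gt_eqF.
rewrite normrM (gtr0_norm (_ : 0 < (lo + hi)^-1)) ?invr_gt0 //.
rewrite ler_pM2r ?invr_gt0 // ler_norml; lra.
Qed.

(** Each factor of [X ^+ p] moves by a distance of at most one. *)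
Lemma banded_expr_entry (dist : 'I_n -> 'I_n -> nat) (X : 'M[R]_n) p k t :
    (forall i, dist i i = 0%N) ->
    (forall i j l, dist i l <= dist i j + dist j l)%N ->
    (forall i j, (1 < dist i j)%N -> X i j = 0) ->
  (p < dist k t)%N -> (X ^+ p) k t = 0.
Proof.
move=> dist0 distD X0; elim: p k => [|p IHp] k pkt.
  by rewrite mxE; case: eqP pkt => // ->; rewrite dist0.
rewrite exprS mxE big1 // => j _.
have [/X0->|kj] := ltnP 1 (dist k j); first by rewrite mul0r.
rewrite IHp ?mulr0 //; have := distD k j t; lia.
Qed.

(** The first [dist k t] terms of the Neumann series vanish at [(k, t)], so only
    the remainder after them contributes to the entry. *)
Lemma inverse_entry_decay (dist : 'I_n -> 'I_n -> nat) k t :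
    (forall i, dist i i = 0%N) ->
    (forall i j l, dist i l <= dist i j + dist j l)%N ->
    (forall i j, (1 < dist i j)%N -> A i j = 0) ->
  `|invmx A k t| <= lo^-1 * ((hi - lo) / (lo + hi)) ^+ dist k t.
Proof.
move=> dist0 distD A0.
have B0 i j : (1 < dist i j)%N -> B i j = 0.
  move=> ij; rewrite !mxE A0 // mulr0 subr0; case: eqP ij => // ->.
  by rewrite dist0.
set d := dist k t; pose c := 2 / (lo + hi).
have geom : invmx A = c *: (\sum_(p < d) B ^+ p) + invmx A *m B ^+ d.
  have cA : c *: A = 1 - B by rewrite /B opprB addrC subrK.
  have AS : A *m (c *: \sum_(p < d) B ^+ p) = 1 - B ^+ d.
    rewrite -scalemxAr scalemxAl cA -[_ *m _]/(_ * _).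
    by rewrite -(opprB B) mulNr -subrX1 opprB.
  by rewrite -(mulKmx spectrum_in_unitmx (c *: _)) AS -mulmxDr subrK mulmx1.
rewrite geom mxE [X in `|X + _|]mxE summxE big1 ?mulr0 ?add0r.
  exact: inverse_remainder_entry_le.
by move=> p _; exact: (banded_expr_entry dist0 distD B0).
Qed.

End InverseDecay.

End Spectral.

(** * The Kronecker sum of a tridiagonal matrix *)

Lemma real_complex_embedding (R : rcfType) : real_embedding (real_complex R).
Proof. by split=> [x y|z /complex_realP[x ->]]; [rewrite lecR | exists x]. Qed.

(** The [l1] distance between two positions (block, row) of the grid which the
    indices of a Kronecker sum enumerate. *)
Definition grid_dist n (k t : 'I_(n * n)) : nat :=
  (`|k %/ n - t %/ n| + `|k %% n - t %% n|)%N.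

Lemma grid_distE n (k t : 'I_(n * n)) :
  (`|row_of n k.+1 - row_of n t.+1| + `|block_of n k.+1 - block_of n t.+1|)%N
  = grid_dist k t.
Proof.
rewrite /grid_dist /row_of /block_of !subn1 /= addnC distnDr.
have rowE (u : nat) : (u.+1 - n * (u %/ n) = u %% n + 1)%N.
  by rewrite {1}(divn_eq u n); lia.
by rewrite !rowE distnDr.
Qed.

Lemma grid_distii n (i : 'I_(n * n)) : grid_dist i i = 0%N.
Proof. by rewrite /grid_dist !distnn. Qed.

Lemma grid_dist_triangle n (i j l : 'I_(n * n)) :
  (grid_dist i l <= grid_dist i j + grid_dist j l)%N.
Proof. by rewrite /grid_dist addnACA leq_add // leqD_dist. Qed.

Lemma kron_sum_banded (R : pzRingType) n (M : 'M[R]_n) (i j : 'I_(n * n)) :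
  tridiagonal M -> (1 < grid_dist i j)%N -> kron_sum M i j = 0.
Proof.
move=> triM ij; rewrite /kron_sum !mxE.
set i1 := (mxtens_unindex i).1; set i2 := (mxtens_unindex i).2.
set j1 := (mxtens_unindex j).1; set j2 := (mxtens_unindex j).2.
have {}ij : (1 < `|i1 - j1| + `|i2 - j2|)%N by [].
have [e2|_] := eqVneq i2 j2; have [e1|_] := eqVneq i1 j1;
  rewrite /= ?mulr1n ?mulr0n ?mulr0 ?mul0r ?mulr1 ?mul1r ?addr0 ?add0r //.
- by move: ij; rewrite e1 e2 !distnn.
- by apply: triM; move: ij; rewrite e2 distnn addn0.
- by apply: triM; move: ij; rewrite e1 distnn.
Qed.

Lemma kron_sum_inverse_decay (R : rcfType) n (M : 'M[R]_n) (a b : R) k t :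
    M^T = M -> tridiagonal M -> 0 < a ->
    (forall c, eigenvalue M c -> a <= c <= b) ->
  `|invmx (kron_sum M) k t| <=
    (2 * a)^-1 * ((b - a) / (a + b)) ^+ grid_dist k t.
Proof.
move=> symM triM a_gt0 eigM.
have embC := real_complex_embedding R.
have spec := kron_sum_spectrum_in (symmetric_spectrum_in embC symM eigM).
have a2_gt0 : 0 < 2 * a by rewrite mulr_gt0.
have banded i j : (1 < grid_dist i j)%N -> kron_sum M i j = 0.
  exact: kron_sum_banded.
have := inverse_entry_decay embC a2_gt0 spec k t (@grid_distii n)
  (@grid_dist_triangle n) banded.
by rewrite -mulrBr -mulrDr -mulf_div divff ?pnatr_eq0 ?mul1r.
Qed.

Lemma posdefmx_eigenvalue_gt0 (R : realFieldType) n (M : 'M[R]_n) a :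
  posdefmx M -> eigenvalue M a -> 0 < a.
Proof.
move=> posM /eigenvalueP[v vM v0].
have vT0 : v^T != 0 by rewrite trmx_eq0.
have := posM _ vT0; rewrite trmxK vM -scalemxAl mxE.
have : 0 <= (v *m v^T) 0 0.
  by rewrite mxE sumr_ge0 // => i _; rewrite mxE -expr2 sqr_ge0.
by move=> vv; apply: contraTT; rewrite -!leNgt => a0; rewrite mulr_le0_ge0.
Qed.

(** * Comparison with the stated bounds *)

Section RealBounds.
Variables (R : realFieldType) (a b : R).
Hypotheses (a_gt0 : 0 < a) (leab : a <= b).

Let b_gt0 : 0 < b. Proof. exact: lt_le_trans leab. Qed.

(** This is [((a + b)^2 / q)^n >= 1 + n * a / b] for [q = a^2 + b^2].  The ratio
    is [1 + 2ab / q], and [q <= 2 b^2] makes it at least [1 + a / b]. *)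
Lemma bernoulli_ratio n :
  (a ^+ 2 + b ^+ 2) ^+ n * (b + n%:R * a) <= b * ((a + b) ^+ 2) ^+ n.
Proof.
elim: n => [|n IHn]; first by rewrite !expr0 mul1r mul0r addr0 mulr1.
set q := a ^+ 2 + b ^+ 2 in IHn *; set s := (a + b) ^+ 2 in IHn *.
have s_ge0 : 0 <= s by rewrite sqr_ge0.
have qn_ge0 : 0 <= q ^+ n by rewrite exprn_ge0 // addr_ge0 ?sqr_ge0.
have step : q * (b + n.+1%:R * a) <= s * (b + n%:R * a).
  rewrite -subr_ge0 -natr1 (_ : _ - _ =
    a * ((b - a) * (a + b)) + 2 * n%:R * (a ^+ 2 * b)); last first.
    by rewrite /q /s; ring.
  by rewrite addr_ge0 // !mulr_ge0 ?exprn_ge0 ?subr_ge0 ?addr_ge0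
    ?(ltW a_gt0) ?(ltW b_gt0).
rewrite !exprSr -mulrA (le_trans (ler_wpM2l qn_ge0 step)) //.
rewrite mulrCA [leLHS]mulrC [b * _]mulrA.
exact: ler_wpM2r.
Qed.

(** With the exponential part settled by Bernoulli, it remains to absorb the
    linear factor [n + x] by the [m] spare powers of [(a + b)^2]. *)
Lemma ratio_power_bound n m K x :
    K * (n%:R + x) * b <= (b + n%:R * a) * ((a + b) ^+ 2) ^+ m ->
  (a ^+ 2 + b ^+ 2) ^+ n * K * (n%:R + x) <= ((a + b) ^+ 2) ^+ (n + m).
Proof.
move=> Kle; rewrite -(ler_pM2l b_gt0) exprD.
have qn_ge0 : 0 <= (a ^+ 2 + b ^+ 2) ^+ n.
  by rewrite exprn_ge0 // addr_ge0 ?sqr_ge0.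
have sm_ge0 : 0 <= ((a + b) ^+ 2) ^+ m by rewrite exprn_ge0 ?sqr_ge0.
have Kle' := ler_wpM2l qn_ge0 Kle.
have bern := ler_wpM2r sm_ge0 (bernoulli_ratio n).
move: ((a ^+ 2 + b ^+ 2) ^+ n) (((a + b) ^+ 2) ^+ m) (((a + b) ^+ 2) ^+ n)
  Kle' bern => Q S T Kle' bern.
lra.
Qed.

(** The square of the inequality that the bound for [l <> i] and [m <> j]
    amounts to, with [n.+1] in the role of its exponent [n2].  The hypothesis
    of [ratio_power_bound] holds because the difference of its two sides
    expands to a polynomial with nonnegative coefficients. *)
Lemma off_axis_bound n :
  (a ^+ 2 + b ^+ 2) ^+ n * (a * b ^+ 2) ^+ 2 * (n%:R + 5) <=
  ((a + b) ^+ 2) ^+ (n + 3).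
Proof.
apply: ratio_power_bound; rewrite -subr_ge0 (_ : _ - _ =
  b ^+ 7 + 6 * (a * b ^+ 6) + 10 * (a ^+ 2 * b ^+ 5)
  + 20 * (a ^+ 3 * b ^+ 4) + 15 * (a ^+ 4 * b ^+ 3) + 6 * (a ^+ 5 * b ^+ 2)
  + a ^+ 6 * b
  + n%:R * (a * b ^+ 6 + 5 * (a ^+ 2 * b ^+ 5) + 15 * (a ^+ 3 * b ^+ 4)
    + 20 * (a ^+ 4 * b ^+ 3) + 15 * (a ^+ 5 * b ^+ 2) + 6 * (a ^+ 6 * b)
    + a ^+ 7)); last by ring.
by rewrite !(addr_ge0, mulr_ge0) ?exprn_ge0 ?(ltW a_gt0) ?(ltW b_gt0).
Qed.

(** The counterpart for indices that share a row or a block, with [n.+1] in the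
    role of [n1]. *)
Lemma axis_bound n :
  (a ^+ 2 + b ^+ 2) ^+ n * (a * b) ^+ 2 * (n%:R + 3) <=
  ((a + b) ^+ 2) ^+ (n + 2).
Proof.
apply: ratio_power_bound; rewrite -subr_ge0 (_ : _ - _ =
  b ^+ 5 + 4 * (a * b ^+ 4) + 3 * (a ^+ 2 * b ^+ 3)
  + 4 * (a ^+ 3 * b ^+ 2) + a ^+ 4 * b
  + n%:R * (a * b ^+ 4 + 3 * (a ^+ 2 * b ^+ 3) + 6 * (a ^+ 3 * b ^+ 2)
    + 4 * (a ^+ 4 * b) + a ^+ 5)); last by ring.
by rewrite !(addr_ge0, mulr_ge0) ?exprn_ge0 ?(ltW a_gt0) ?(ltW b_gt0).
Qed.

End RealBounds.

(** The factors [sqrt 2] and [sqrt n.+1] of the stated bounds cancel, which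
    leaves [(2a)^-1 * (b - a)^d / (q^(n/2) * P * sqrt (n + x))] with
    [q = a^2 + b^2].  Comparing it with the Neumann bound is the square root of
    the polynomial inequality assumed here; [P] and [x] tell the two cases
    apart. *)
Lemma neumann_bound_le (R : realType) (a b P x : R) (n d : nat) :
    0 < a -> a <= b -> 0 < P -> 0 < x ->
    (a ^+ 2 + b ^+ 2) ^+ n * P ^+ 2 * (n%:R + x) <= ((a + b) ^+ 2) ^+ d ->
  (2 * a)^-1 * ((b - a) / (a + b)) ^+ d <=
  1 / (2 * Num.sqrt 2) * ((b - a) ^+ d / (b ^+ 2 + a ^+ 2) `^ (n.+1%:R / 2))
  * (Num.sqrt (b ^+ 2 + a ^+ 2) / (a * P)) * (1 / Num.sqrt n.+1%:R)
  * Num.sqrt ((2 * n.+1%:R) / (n%:R + x)).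
Proof.
move=> a_gt0 leab P_gt0 x_gt0; rewrite [X in X ^+ n]addrC.
have b_gt0 : 0 < b by exact: lt_le_trans leab.
set q := b ^+ 2 + a ^+ 2 => qP.
have q_gt0 : 0 < q by rewrite addr_gt0 ?exprn_gt0.
have y_gt0 : 0 < n%:R + x :> R by rewrite ltr_wpDl.
set w := Num.sqrt q; set y := n%:R + x in qP y_gt0 *.
have w_gt0 : 0 < w by rewrite sqrtr_gt0.
have sqrty_gt0 : 0 < Num.sqrt y by rewrite sqrtr_gt0.
have powE : q `^ (n.+1%:R / 2) = w ^+ n.+1.
  by rewrite mulrC powRrM powR12_sqrt ?ltW // powR_mulrn ?sqrtr_ge0.
have rootP : w ^+ n * P * Num.sqrt y <= (a + b) ^+ d.
  rewrite -ler_sqr ?nnegrE; last first.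
  - by rewrite exprn_ge0 ?addr_ge0 ?ltW.
  - by rewrite !mulr_ge0 ?exprn_ge0 ?sqrtr_ge0 ?ltW.
  rewrite !exprMn [w ^+ n ^+ 2]exprAC [(a + b) ^+ d ^+ 2]exprAC.
  by rewrite (sqr_sqrtr (ltW q_gt0)) (sqr_sqrtr (ltW y_gt0)).
have -> : 1 / (2 * Num.sqrt 2) * ((b - a) ^+ d / q `^ (n.+1%:R / 2))
  * (w / (a * P)) * (1 / Num.sqrt n.+1%:R) * Num.sqrt ((2 * n.+1%:R) / y)
  = (2 * a)^-1 * ((b - a) ^+ d / (w ^+ n * P * Num.sqrt y)).
  rewrite powE exprS !sqrtrM ?sqrtrV ?mulr_ge0 ?ltW //.
  by field; rewrite !gt_eqF ?sqrtr_gt0 ?exprn_gt0 ?ltr0n.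
rewrite ler_pM2l ?invr_gt0 ?mulr_gt0 // expr_div_n.
rewrite ler_wpM2l ?exprn_ge0 ?subr_ge0 // lef_pV2 ?posrE //.
  by rewrite exprn_gt0 ?addr_gt0.
by rewrite !mulr_gt0 ?exprn_gt0.
Qed.

Theorem proposition2p3 :
  forall (R : realType) (n : nat) (M : 'M[R]_n) (lmin lmax : R),
  M^T = M -> posdefmx M -> tridiagonal M ->
  smallest_eigenvalue M lmin -> largest_eigenvalue M lmax ->
  let S := kron_sum M in
  (* k and t are 0-based matrix indices: the paper's 1-based ones are k.+1, t.+1 *)
  forall k t : 'I_(n * n),
  let j := block_of n t.+1 in
  let i := row_of n t.+1 in
  let m := block_of n k.+1 in
  let l := row_of n k.+1 in
  (let n2 := (`|l - i| + `|m - j| - 2)%N in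
   (0 < n2)%N -> l <> i -> m <> j ->
   `|invmx S k t| <=
     1 / (2 * Num.sqrt 2)
     * ((lmax - lmin) ^+ (n2 + 2) / (lmax ^+ 2 + lmin ^+ 2) `^ (n2%:R / 2))
     * (Num.sqrt (lmax ^+ 2 + lmin ^+ 2) / (lmax * lmin) ^+ 2)
     * (1 / Num.sqrt n2%:R)
     * Num.sqrt ((2 * n2%:R) / (n2%:R + 4)))
  /\
  (let n1 := (`|l - i| + `|m - j| - 1)%N in
   (0 < n1)%N -> l = i \/ m = j ->
   `|invmx S k t| <=
     1 / (2 * Num.sqrt 2)
     * ((lmax - lmin) ^+ (n1 + 1) / (lmax ^+ 2 + lmin ^+ 2) `^ (n1%:R / 2))
     * (Num.sqrt (lmax ^+ 2 + lmin ^+ 2) / (lmax * lmin ^+ 2))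
     * (1 / Num.sqrt n1%:R)
     * Num.sqrt ((2 * n1%:R) / (n1%:R + 2))).
Proof.
move=> R n M a b symM posM triM [eig_a a_min] [eig_b b_max] S k t j i m l.
have a_gt0 : 0 < a := posdefmx_eigenvalue_gt0 posM eig_a.
have leab : a <= b := a_min _ eig_b.
have b_gt0 : 0 < b := lt_le_trans a_gt0 leab.
have decay :
    `|invmx S k t| <= (2 * a)^-1 * ((b - a) / (a + b)) ^+ grid_dist k t.
  apply: kron_sum_inverse_decay => // c eig_c.
  by rewrite a_min ?b_max.
have distE : (`|l - i| + `|m - j|)%N = grid_dist k t := grid_distE k t.
split=> [n2 n2_gt0 _ _|n1 n1_gt0 _]; apply: le_trans decay _.
- have [n' n2E] : exists n', n2 = n'.+1 by exists n2.-1; rewrite prednK.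
  have dE : grid_dist k t = (n' + 3)%N by rewrite -distE; move: n2E n2_gt0; lia.
  rewrite n2E dE (_ : n'.+1 + 2 = n' + 3)%N; last by rewrite addn2 addn3.
  rewrite (_ : (b * a) ^+ 2 = a * (a * b ^+ 2)); last by ring.
  rewrite (_ : n'.+1%:R + 4 = n'%:R + 5); last by rewrite -natr1; ring.
  apply: neumann_bound_le => //; first by rewrite mulr_gt0 ?exprn_gt0.
  exact: off_axis_bound.
- have [n' n1E] : exists n', n1 = n'.+1 by exists n1.-1; rewrite prednK.
  have dE : grid_dist k t = (n' + 2)%N by rewrite -distE; move: n1E n1_gt0; lia.
  rewrite n1E dE (_ : n'.+1 + 1 = n' + 2)%N; last by rewrite addn1 addn2.
  rewrite (_ : b * a ^+ 2 = a * (a * b)); last by ring.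
  rewrite (_ : n'.+1%:R + 2 = n'%:R + 3); last by rewrite -natr1; ring.
  apply: neumann_bound_le => //; first by rewrite mulr_gt0.
  exact: axis_bound.
Qed.
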